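(* For every string $w$, $m(w) \le b(w)$, where $m(w)$ is the size of the smallest internal macro system generating $w$ and $b(w)$ is the number of phrases of the smallest bidirectional macro scheme for $w$.
   Context: Bidirectional macro scheme: for a string $w[1,n]$, a bidirectional macro scheme of size $k$ is a sequence $(x_1,s_1),\ldots,(x_k,s_k)$ with $w = x_1\cdots x_k$, where $x_i = w[s_i, s_i+|x_i|-1]$ if $|x_i|>1$, and $s_i=\bot$ if $|x_i|=1$ (a phrase of length 1 may also be given explicitly). Let $p_i = 1+\sum_{j<i}|x_j|$ be the starting position of $x_i$. The induced function $f:[1,n]\to[1,n]\cup\{\bot\}$ is defined, for a position $i$ with $p_j \le i < p_{j+1}$, by $f(i)=\bot$ if $s_j=\bot$ and $f(i) = s_j + i - p_j$ otherwise. The scheme is valid if for every position $i$ there is $r$ with $f^r(i)=\bot$. $b(w)$ is the minimum size $k$ of a valid bidirectional macro scheme for $w$. Macro system: a tuple $M=(V,\Sigma,R,S)$ with $V$ a finite set of variables, $\Sigma$ a finite set of terminals disjoint from $V$, $S\in V$ the initial variable, and $R$ assigning to each variable $A$ exactly one rule $A\to\alpha$ with $\alpha \in (V\cup\Sigma\cup\{A'[i,j] : A'\in V,\ i,j\in\mathbb{N}\})^*$ (symbols $A'[i,j]$ are called extractions); the rule $A\to\varepsilon$ is allowed only for $A=S$. Its size is $\sum_{A\in V}|R(A)|$, each extraction counting as one symbol. Expansions are defined by $exp(a)=a$ for $a\in\Sigma$, $exp(A)=exp(B_1)\cdots exp(B_k)$ if $A\to B_1\cdots B_k$ (and $exp(S)=\varepsilon$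 if $S\to\varepsilon$), and $exp(A[i,j]) = exp(A)[i,j]$ (substring). The macro system is valid if these equations have a single solution $w=exp(S)\in\Sigma^*$; it then generates $w$. It is internal if $exp(A)$ appears as a substring of $w$ for every $A\in V$. $m(w)$ is the size of the smallest valid internal macro system generating $w$. *)

(* Defs.v *)
From HB Require Import structures.
From mathcomp Require Import all_boot.
From mathcomp Require Import boolp.

Set Implicit Arguments.
Unset Strict Implicit.
Unset Printing Implicit Defensive.

(* [substr w i j] is w[i,j], with positions counted from 1.  It is partial:
   w[i,j] is undefined (None) unless 1 <= i <= j <= |w|.  In particular an
   out-of-range interval is neither truncated nor read as the empty string:
   with either of these conventions, x = x[2,3] a would have the spurious
   solution x = a besides x = aaa. *)
Definition substr (T : Type) (w : seq T) (i j : nat) : option (seq T) :=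
  if [&& 0 < i, i <= j & j <= size w] then Some (drop i.-1 (take j w))
  else None.

Section BidirectionalMacroScheme.

Variable T : finType.

(* The sequence of pairs (x_j, s_j), where None stands for ⊥.  Phrases are
   indexed from 0, whereas text positions are counted from 1. *)
Definition bms : Type := seq (seq T * option nat).

Definition phrase (B : bms) (j : nat) : seq T * option nat :=
  nth ([::], None) B j.

Definition phrase_start (B : bms) (j : nat) : nat :=
  1 + \sum_(l < j) size (phrase B l).1.

(* Phrases are nonempty, and those of length 1 are exactly the explicit ones. *)
Definition phrase_ok (w : seq T) (xs : seq T * option nat) : Prop :=
  match xs.2 with
  | None => size xs.1 = 1
  | Some s => 1 < size xs.1 /\ substr w s (s + size xs.1 - 1) = Some xs.1
  end.

Definition bms_for (w : seq T) (B : bms) : Prop :=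
  w = flatten [seq xs.1 | xs <- B] /\
  (forall j, j < size B -> phrase_ok w (phrase B j)).

Definition phrase_index (B : bms) (i : nat) : nat :=
  find (fun j => phrase_start B j <= i < phrase_start B j.+1)
       (iota 0 (size B)).

(* The induced function; only its values at text positions are relevant. *)
Definition bms_fun (B : bms) (i : nat) : option nat :=
  let j := phrase_index B i in
  if (phrase B j).2 is Some s then Some (s + i - phrase_start B j) else None.

Definition bms_valid (w : seq T) (B : bms) : Prop :=
  forall i, 1 <= i <= size w ->
    exists r, iter r (obind (bms_fun B)) (Some i) = None.

Definition has_bms_of_size (w : seq T) (k : nat) : Prop :=
  exists B : bms, [/\ bms_for w B, bms_valid w B & size B = k].

Lemma has_bms (w : seq T) : exists k, `[< has_bms_of_size w k >].
Proof.
pose B : bms := [seq ([:: a], None) | a <- w].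
have BN j : (phrase B j).2 = None.
  rewrite /phrase; have [jB|jB] := ltnP j (size B); last by rewrite nth_default.
  by have /mapP[a _ ->] := mem_nth ([::], None) jB.
exists (size w); apply/asboolP; exists B; split; last by rewrite size_map.
- split; first by rewrite /B -map_comp /comp /=; elim: w {B BN} => //= a w <-.
  move=> j jB; rewrite /phrase.
  by have /mapP[a _ ->] := mem_nth ([::], None) jB.
- by move=> i _; exists 1; rewrite /= /bms_fun BN.
Qed.

Definition b_measure (w : seq T) : nat := ex_minn (has_bms w).

End BidirectionalMacroScheme.

Inductive msymbol (V T : Type) : Type :=
  | MVar of V
  | MTerm of T
  | MExtract of V & nat & nat.

Arguments MVar {V T}.
Arguments MTerm {V T}.
Arguments MExtract {V T}.

Record macro_system (T : finType) : Type := MacroSystem {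
  mvar : finType;
  mrule : mvar -> seq (msymbol mvar T);
  minit : mvar;
  _ : forall A, mrule A = [::] -> A = minit
}.

Section MacroSystem.

Variable T : finType.

Definition msize (M : macro_system T) : nat :=
  \sum_(A : mvar M) size (mrule A).

Definition exp_symbol (V : Type) (e : V -> seq T) (s : msymbol V T) :
    option (seq T) :=
  match s with
  | MVar A => Some (e A)
  | MTerm a => Some [:: a]
  | MExtract A i j => substr (e A) i j
  end.

Fixpoint exp_rhs (V : Type) (e : V -> seq T) (alpha : seq (msymbol V T)) :
    option (seq T) :=
  if alpha is s :: alpha' then
    obind (fun u => omap (cat u) (exp_rhs e alpha')) (exp_symbol e s)
  else Some [::].

(* All extractions have to be defined for the equations to hold. *)
Definition msolution (M : macro_system T) (e : mvar M -> seq T) : Prop :=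
  forall A, exp_rhs e (mrule A) = Some (e A).

Definition is_expansion (M : macro_system T) (e : mvar M -> seq T) : Prop :=
  msolution e /\ (forall e', @msolution M e' -> e' =1 e).

Definition mvalid (M : macro_system T) : Prop := exists e, @is_expansion M e.

Definition mgenerates (M : macro_system T) (w : seq T) : Prop :=
  exists2 e, @is_expansion M e & e (minit M) = w.

Definition minternal (M : macro_system T) : Prop :=
  exists2 e, @is_expansion M e & forall A, infix (e A) (e (minit M)).

Definition has_internal_macro_system_of_size (w : seq T) (k : nat) : Prop :=
  exists M : macro_system T,
    [/\ mvalid M, minternal M, mgenerates M w & msize M = k].

Lemma has_internal_macro_system (w : seq T) :
  exists k, `[< has_internal_macro_system_of_size w k >].
Proof.
pose R (_ : unit) : seq (msymbol unit T) := map MTerm w.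
have Reps A : R A = [::] -> A = tt by case: A.
pose M := MacroSystem Reps.
have expR e : exp_rhs e (map MTerm w : seq (msymbol unit T)) = Some w.
  by rewrite {R Reps M}; elim: w => //= a w ->.
have Mw : @is_expansion M (fun=> w).
  split=> [A|e' e'sol A]; first exact: expR.
  by have := e'sol A; rewrite expR => -[].
exists (msize M); apply/asboolP; exists M; split=> //.
- by exists (fun=> w).
- by exists (fun=> w) => // A; exact: infix_refl.
- by exists (fun=> w).
Qed.

Definition m_measure (w : seq T) : nat :=
  ex_minn (has_internal_macro_system w).

End MacroSystem.

(* Main.v *)
(** A bidirectional macro scheme becomes a macro system with a single variable
    S, whose rule has one symbol per phrase: the letter itself for an explicit
    phrase, and S[s, s + l - 1] for a phrase of length l copied from s.  The
    source string w solves the resulting equation.  In any solution u, a defined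
    extraction has the length of the phrase it stands for, so u and w are cut
    into phrases at the same positions; hence u agrees with w at explicit
    positions and satisfies u_i = u_(f i) elsewhere, and validity of the scheme
    propagates the agreement to all positions. *)
Require Import Defs.
From mathcomp Require Import all_boot.
From mathcomp Require Import boolp zify.

Set Implicit Arguments.
Unset Strict Implicit.
Unset Printing Implicit Defensive.

Lemma nth_flatten_index (T : Type) (x0 : T) (ss : seq (seq T)) (r c : nat) :
  c < size (nth [::] ss r) ->
  nth x0 (flatten ss) (sumn (take r (shape ss)) + c) = nth x0 (nth [::] ss r) c.
Proof.
move=> cr; have cr' : c < nth 0 (shape ss) r.
  have [rs|rs] := ltnP r (size ss); first by rewrite (nth_map [::]).
  by rewrite nth_default in cr.
by rewrite nth_flatten flatten_indexKl // flatten_indexKr.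
Qed.

(** Since [substr] never truncates, definedness alone fixes the length of the result from the
    bounds, whatever [w] is. *)
Lemma substr_SomeP (T : Type) (w x : seq T) (i j : nat) :
  substr w i j = Some x ->
  [/\ 0 < i, i <= j <= size w, size x = j.+1 - i &
      forall x0 c, c < size x -> nth x0 x c = nth x0 w (i.-1 + c)].
Proof.
rewrite /substr; case: ifP => // /and3P[i0 ij jw] [<-].
have sz : size (drop i.-1 (take j w)) = j.+1 - i.
  by rewrite size_drop size_takel //; lia.
split=> //; first by rewrite ij.
by move=> x0 c; rewrite sz => cx; rewrite nth_drop nth_take //; lia.
Qed.

Section ExpRhs.

Variables (T : finType) (V : Type) (e : V -> seq T).
Variables (X : eqType) (g : X -> msymbol V T).

Lemma exp_rhs_map (P : X -> seq T) (s : seq X) :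
  {in s, forall x, exp_symbol e (g x) = Some (P x)} ->
  exp_rhs e (map g s) = Some (flatten (map P s)).
Proof.
elim: s => //= x s IHs Ps; rewrite Ps ?mem_head //= IHs // => y ys.
by apply: Ps; rewrite inE ys orbT.
Qed.

(** A function [P] suffices to record the pieces of [u]: equal entries of [s] give equal symbols,
    hence equal expansions. *)
Lemma exp_rhs_map_inv (s : seq X) (u : seq T) :
  exp_rhs e (map g s) = Some u ->
  exists2 P : X -> seq T, {in s, forall x, exp_symbol e (g x) = Some (P x)} &
    u = flatten (map P s).
Proof.
(* The default [[::]] never occurs on [s]: one undefined symbol would make the whole right-hand side
   undefined. *)
move=> su; pose P x := odflt [::] (exp_symbol e (g x)).
suff sP : {in s, forall x, exp_symbol e (g x) = Some (P x)}.
  by exists P => //; have := exp_rhs_map sP; rewrite su => -[].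
elim: s u su => //= x s IHs u; case E: (exp_symbol e (g x)) => [y|] //=.
case F: (exp_rhs e (map g s)) => [v|] //= _ z.
by rewrite inE => /predU1P[->|]; [rewrite /P E | exact: IHs F z].
Qed.

End ExpRhs.

Section SchemeToSystem.

Variable T : finType.
Implicit Types (w : seq T) (B : bms T).

(** Links 1-based text positions to the 0-based offsets used for flattened sequences. *)
Lemma phrase_startE B j :
  phrase_start B j = (sumn (take j (shape [seq xs.1 | xs <- B]))).+1.
Proof.
rewrite /phrase_start add1n; congr _.+1; elim: B j => [|xs B IHB] [|j] /=.
- by rewrite big_ord0.
- by rewrite big1 // => l _; rewrite /phrase nth_nil.
- by rewrite big_ord0.
- by rewrite big_ord_recl /= -IHB.
Qed.

Lemma phrase_startS B j :
  phrase_start B j.+1 = phrase_start B j + size (phrase B j).1.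
Proof. by rewrite /phrase_start big_ord_recr /= addnA. Qed.

Lemma phrase_indexP B i :
  1 <= i <= size (flatten [seq xs.1 | xs <- B]) ->
  phrase_index B i < size B /\
  phrase_start B (phrase_index B i) <= i < phrase_start B (phrase_index B i).+1.
Proof.
move=> /andP[i0 iB]; pose p j := phrase_start B j <= i < phrase_start B j.+1.
have hp : has p (iota 0 (size B)).
  set sh := shape [seq xs.1 | xs <- B].
  have i1 : i.-1 < sumn sh by rewrite -size_flatten; lia.
  have rB := reshape_indexP i1; have cr := reshape_offsetP i1.
  have iE := reshape_indexK sh i.-1.
  (* The witness is the row containing the 0-based index [i.-1] when the text is cut back into
     phrases. *)
  apply/hasP; exists (reshape_index sh i.-1).
    by rewrite mem_iota add0n; move: rB; rewrite !size_map.
  rewrite /p phrase_startS phrase_startE -/sh.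
  have szE : size (phrase B (reshape_index sh i.-1)).1
             = nth 0 sh (reshape_index sh i.-1).
    move: rB; rewrite /sh /shape -map_comp size_map => rB.
    by rewrite (nth_map ([::], None)).
  by rewrite szE; rewrite /flatten_index in iE; lia.
have jB : phrase_index B i < size B.
  by rewrite -[X in _ < X](size_iota 0) -has_find.
by split=> //; have := nth_find 0 hp; rewrite nth_iota.
Qed.

(* The [MVar] branch is never reached on well-formed phrases. *)
Definition phrase_symbol (xs : seq T * option nat) : msymbol unit T :=
  match xs.2 with
  | Some s => MExtract tt s (s + size xs.1 - 1)
  | None => if xs.1 is a :: _ then MTerm a else MVar tt
  end.

Lemma map_phrase_symbol_nil B (A : unit) :
  map phrase_symbol B = [::] -> A = tt.
Proof. by case: A. Qed.

Definition system_of_bms B : macro_system T :=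
  @MacroSystem T unit (fun=> map phrase_symbol B) tt
    (map_phrase_symbol_nil (B := B)).

Lemma msize_system_of_bms B : msize (system_of_bms B) = size B.
Proof. by rewrite /msize /= sum_nat_const card_unit mul1n size_map. Qed.

Lemma phrase_ok_exp w xs :
  phrase_ok w xs -> exp_symbol (fun=> w) (phrase_symbol xs) = Some xs.1.
Proof.
case: xs => [x [s|]]; first by case=> /= _ ->.
by case: x => [|a []].
Qed.

(** The bounds [s] and [s + size xs.1 - 1] determine the length, so [e] may be any candidate
    solution. *)
Lemma phrase_ok_exp_size w xs (e : unit -> seq T) y :
  phrase_ok w xs -> exp_symbol e (phrase_symbol xs) = Some y ->
  size y = size xs.1.
Proof.
case: xs => [x [s|]] /=; last by case: x => [|a []] //= _ [<-].
by case=> /= x1 _ /substr_SomeP[s0 _ -> _]; lia.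
Qed.

Lemma bms_for_in w B xs : bms_for w B -> xs \in B -> phrase_ok w xs.
Proof.
by move=> [_ Bok] /(nthP ([::], None))[j jB <-]; exact: Bok.
Qed.

Lemma bms_solution w B :
  bms_for w B -> @msolution T (system_of_bms B) (fun=> w).
Proof.
move=> Bw A; rewrite /= [in RHS]Bw.1.
by apply: exp_rhs_map => xs xsB; exact: phrase_ok_exp (bms_for_in Bw xsB).
Qed.

Lemma bms_solution_unique w B (e : unit -> seq T) :
  bms_for w B -> bms_valid w B -> @msolution T (system_of_bms B) e ->
  e tt = w.
Proof.
move=> Bw Bval /(_ tt) /= /exp_rhs_map_inv[P eP eE].
have wE := Bw.1; pose W := [seq xs.1 | xs <- B].
have szP xs : xs \in B -> size (P xs) = size xs.1.
  by move=> xsB; exact: phrase_ok_exp_size (bms_for_in Bw xsB) (eP _ xsB).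
have shE : shape (map P B) = shape W.
  by rewrite /shape -!map_comp; apply/eq_in_map => xs xsB /=; exact: szP.
have sze : size (e tt) = size w by rewrite eE wE !size_flatten shE.
(* Agreement is proved letter by letter, by induction on the number [r] of steps leading from [i] to
   ⊥. *)
suff ew x0 r i : 1 <= i <= size w ->
    iter r (obind (bms_fun B)) (Some i) = None ->
    nth x0 (e tt) i.-1 = nth x0 w i.-1.
  (* The alphabet may be empty, so the default letter [x0] for [nth] is taken from [w], and empty
     [w] is treated apart. *)
  have [w0|] := posnP (size w).
    by rewrite (size0nil w0); apply: size0nil; rewrite sze w0.
  case E: w => [//|x0 w'] _; rewrite -E; apply: (@eq_from_nth _ x0) => // i.
  rewrite sze => iw; have iw1 : 1 <= i.+1 <= size w by [].
  by have [r /(ew x0 r _ iw1)] := Bval _ iw1.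
(* Zero steps never reach ⊥; otherwise the first step is split off, leaving [r] steps from the image
   of [i]. *)
elim: r i => [//|r IHr] i iw; rewrite iterSr /=.
have [jB] : phrase_index B i < size B /\
    phrase_start B (phrase_index B i) <= i
      < phrase_start B (phrase_index B i).+1.
  by apply: phrase_indexP; rewrite -wE.
set j := phrase_index B i in jB *; rewrite phrase_startS => /andP[ji ij].
have xsB : phrase B j \in B by exact: mem_nth.
pose c := i - phrase_start B j.
have -> : bms_fun B i = if (phrase B j).2 is Some s then Some (s + c) else None.
  by rewrite /bms_fun -/j; case: (phrase B j).2 => // s; rewrite addnBA.
have cx : c < size (phrase B j).1 by rewrite /c; lia.
have iE : i.-1 = sumn (take j (shape W)) + c.
  by move: ji; rewrite /c phrase_startE -/W; lia.
have -> : nth x0 w i.-1 = nth x0 (phrase B j).1 c.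
  by rewrite iE wE nth_flatten_index (nth_map ([::], None)).
(* Equal shapes place [i] at the same offset [c] of the same piece in [e tt] as in [w]. *)
have -> : nth x0 (e tt) i.-1 = nth x0 (P (phrase B j)) c.
  rewrite iE -shE eE nth_flatten_index (nth_map ([::], None)) //.
  by rewrite szP.
have := bms_for_in Bw xsB; have := eP _ xsB; have := szP _ xsB.
case: (phrase B j) cx => [x [s|]] /= cx szx; last first.
  by case: x {cx szx} => [|a []] //= [<-].
(* In a copied phrase, the letters of [e tt] and [w] at [i] are their letters at [s + c], the image
   of [i], where the induction hypothesis applies. *)
move=> /substr_SomeP[s0 _ _ nthP] [/= x1 /substr_SomeP[_ sw _ nthx]] rN.
rewrite nthP ?szx // nthx //.
have -> : s.-1 + c = (s + c).-1 by lia.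
by apply: IHr => //; lia.
Qed.

(** Internality is immediate: the only variable expands to [w] itself. *)
Lemma bms_internal_macro_system w k :
  has_bms_of_size w k -> has_internal_macro_system_of_size w k.
Proof.
case=> B [Bw Bval Bk]; exists (system_of_bms B).
have wexp : @is_expansion T (system_of_bms B) (fun=> w).
  split; first exact: bms_solution.
  by move=> e esol []; exact: bms_solution_unique esol.
split.
- by exists (fun=> w).
- by exists (fun=> w) => // A; exact: infix_refl.
- by exists (fun=> w).
- by rewrite msize_system_of_bms.
Qed.

End SchemeToSystem.

Theorem theorem1 (Sigma : finType) (w : seq Sigma) :
  m_measure w <= b_measure w.
Proof.
rewrite /m_measure /b_measure.
case: ex_minnP => m _ m_min; case: ex_minnP => b /asboolP wb _.
by apply: m_min; apply/asboolP; exact: bms_internal_macro_system.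
Qed.
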